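(* Let $C\in\mathsf{grK_{tac}}(R)$ and for each $n$ let $r_n=\operatorname{rank}\partial^C_n$. Then for every $n\in\mathbb Z$, $$V(C)=Z\left(\overline{I_{r_n}(\partial^C_n)}\cap\overline{I_{r_{n+1}}(\partial^C_{n+1})}\right).$$ In particular $V(C)$ is a Zariski closed subset of $\mathbb P^{c-1}_k$.
   Context: Standing setup: $Q$ is a regular local ring with maximal ideal $\mathfrak n$ and residue field $k$; $f_1,\dots,f_c\in\mathfrak n^2$ ($c\ge2$) is a $Q$-regular sequence; $P=Q[x_1,\dots,x_c]$ is graded with $Q$ in degree $0$ and $\deg x_i=1$; $w=f_1x_1+\cdots+f_cx_c$ and $R=P/(w)$, an integral domain. For a homomorphism $\varphi$ of finitely generated free $R$-modules, $\operatorname{rank}\varphi$ is the rank of $\varphi$ after tensoring with the fraction field of $R$, and $I_r(\varphi)$ is the ideal of $R$ generated by the $r\times r$ minors of any matrix representing $\varphi$. A complex of finitely generated free modules over a commutative Noetherian ring $A$ is totally acyclic if $H(C)=0=H(\operatorname{Hom}_A(C,A))$. $\mathsf{grK_{tac}}(R)$ is the category of totally acyclic complexes of finitely generated graded free $R$-modules with homogeneous differentials (morphisms: homotopy classes of homogeneous chain maps). A complex is contractible if its identity map is null-homotopic. For $\alpha=(\alpha_1:\dots:\alpha_c)\in\mathbb P^{c-1}_k$, fix lifts $a_i\in Q$ of representative coordinates $\alpha_i$; $R_\alpha=R/(x_1-a_1,\dots,x_c-a_c)\cong Q/(a_1f_1+\cdots+a_cf_c)$ (local with residue field $k$) and $C_\alpha=C\otimes_RR_\alpha$.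 The rank variety is $V(C)=\{\alpha\in\mathbb P^{c-1}_k\mid C_\alpha\text{ is not contractible}\}$. For $p\in R$, $\bar p$ denotes its image under the natural surjection $R\to R/\mathfrak nR=k[x_1,\dots,x_c]$, and $\bar J$ denotes the image of an ideal $J$ of $R$. For a homogeneous ideal $J$ of $k[x_1,\dots,x_c]$, $Z(J)=\{\alpha\in\mathbb P^{c-1}_k\mid p(\alpha)=0\text{ for all homogeneous }p\in J\}$. *)

(* Defs.v *)
From HB Require Import structures.
From mathcomp Require Import all_boot all_order all_algebra.
From mathcomp Require Import fraction.
From mathcomp Require Import mpoly.

Set Implicit Arguments.
Unset Strict Implicit.
Unset Printing Implicit Defensive.

Import GRing.Theory.
Local Open Scope ring_scope.

Definition is_ideal (A : comNzRingType) (I : A -> Prop) : Prop :=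
  I 0 /\ (forall x y, I x -> I y -> I (x + y)) /\
  (forall a x, I x -> I (a * x)).

Definition ideal_gen (A : comNzRingType) (m : nat) (g : 'I_m -> A) (x : A) : Prop :=
  exists r : 'I_m -> A, x = \sum_(i < m) r i * g i.

Definition prime_ideal (A : comNzRingType) (P : A -> Prop) : Prop :=
  is_ideal P /\ ~ P 1 /\ (forall x y, P (x * y) -> P x \/ P y).

Definition noetherian (A : comNzRingType) : Prop :=
  forall I : A -> Prop, is_ideal I ->
    exists m (g : 'I_m -> A), forall x, I x <-> ideal_gen g x.

Definition local_with_max (A : comNzRingType) (mx : A -> Prop) : Prop :=
  is_ideal mx /\ ~ mx 1 /\ (forall x, ~ mx x -> exists y, x * y = 1).

Definition prime_chain (A : comNzRingType) (P : nat -> A -> Prop) (len : nat) : Prop :=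
  (forall i, (i <= len)%N -> prime_ideal (P i)) /\
  (forall i, (i < len)%N ->
     (forall x, P i x -> P i.+1 x) /\ exists x, P i.+1 x /\ ~ P i x).

Definition krull_dim_eq (A : comNzRingType) (d : nat) : Prop :=
  (exists P : nat -> A -> Prop, prime_chain P d) /\
  (forall (P : nat -> A -> Prop) len, prime_chain P len -> (len <= d)%N).

Definition regular_local (A : comNzRingType) (mx : A -> Prop) : Prop :=
  noetherian A /\ local_with_max mx /\
  exists d, krull_dim_eq A d /\
    exists g : 'I_d -> A, forall x, mx x <-> ideal_gen g x.

Definition in_sq (A : comNzRingType) (mx : A -> Prop) (x : A) : Prop :=
  exists N (u v : 'I_N -> A), (forall t, mx (u t) /\ mx (v t)) /\
    x = \sum_(t < N) u t * v t.

Definition regular_seq (A : comNzRingType) (c : nat) (f : 'I_c -> A) : Prop :=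
  (forall i : 'I_c, forall y : A,
     (exists r : 'I_c -> A,
        f i * y = \sum_(j < c | (j < i)%N) r j * f j) ->
     (exists r : 'I_c -> A, y = \sum_(j < c | (j < i)%N) r j * f j)) /\
  ~ ideal_gen f 1.

Definition homog_deg (A : comNzRingType) (c d : nat) (p : {mpoly A[c]}) : bool :=
  all (fun m => mdeg m == d) (msupp p).

Definition wpoly (Q : comNzRingType) (c : nat) (f : 'I_c -> Q) : {mpoly Q[c]} :=
  \sum_(i < c) (f i)%:MP * 'X_i.

(* x in R (a quotient of P via rho) is homogeneous of degree d (d : int);
   only 0 is homogeneous of negative degree *)
Definition homogR (Q : comNzRingType) (c : nat) (R : comNzRingType)
    (rho : {mpoly Q[c]} -> R) (d : int) (x : R) : Prop :=
  match d with
  | Posz n => exists p, homog_deg n p /\ rho p = x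
  | Negz _ => x = 0
  end.

(* b n = rank of C_n, e n i = generator degrees (C_n = sum_i R(-e n i)),
   dd n : 'M_(b n, b (n+1)) is the matrix of d_(n+1) : C_(n+1) -> C_n
   (acting on column vectors).                                         *)

Definition is_complex (R : comNzRingType) (b : int -> nat)
    (dd : forall n : int, 'M[R]_(b n, b (n + 1))) : Prop :=
  forall n : int, dd n *m dd (n + 1) = 0.

Definition homogeneous_diffs (Q : comNzRingType) (c : nat) (R : comNzRingType)
    (rho : {mpoly Q[c]} -> R) (b : int -> nat) (e : forall n : int, 'I_(b n) -> int)
    (dd : forall n : int, 'M[R]_(b n, b (n + 1))) : Prop :=
  forall n (i : 'I_(b n)) (j : 'I_(b (n + 1))),
    homogR rho (e (n + 1) j - e n i) (dd n i j).

Definition acyclic (R : comNzRingType) (b : int -> nat)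
    (dd : forall n : int, 'M[R]_(b n, b (n + 1))) : Prop :=
  forall n (v : 'cV[R]_(b (n + 1))), dd n *m v = 0 ->
    exists u : 'cV[R]_(b (n + 1 + 1)), v = dd (n + 1) *m u.

(* H(Hom_R(C, R)) = 0 ; the dual differential is precomposition *)
Definition dual_acyclic (R : comNzRingType) (b : int -> nat)
    (dd : forall n : int, 'M[R]_(b n, b (n + 1))) : Prop :=
  forall n (v : 'rV[R]_(b (n + 1))), v *m dd (n + 1) = 0 ->
    exists u : 'rV[R]_(b n), v = u *m dd n.

Definition totally_acyclic (R : comNzRingType) (b : int -> nat)
    (dd : forall n : int, 'M[R]_(b n, b (n + 1))) : Prop :=
  is_complex dd /\ acyclic dd /\ dual_acyclic dd.

(* C tensor_R (R/J) is contractible, J the ideal generated by g: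
   there are homotopies s n : C_n -> C_(n+1) over R/J (lifted to R)
   with d s + s d = id modulo J entrywise. *)
Definition contractible_mod (R : comNzRingType) (m : nat) (g : 'I_m -> R)
    (b : int -> nat) (dd : forall n : int, 'M[R]_(b n, b (n + 1))) : Prop :=
  exists s : forall n : int, 'M[R]_(b (n + 1), b n),
    forall n (i j : 'I_(b (n + 1))),
      ideal_gen g ((dd (n + 1) *m s (n + 1) + s n *m dd n - 1%:M) i j).

Definition rank_frac (R : idomainType) (m n : nat) (M : 'M[R]_(m, n)) : nat :=
  \rank (map_mx (@tofrac R) M).

Definition minor_ideal (R : comNzRingType) (m n : nat) (r : nat) (M : 'M[R]_(m, n))
    (x : R) : Prop :=
  exists cf : {ffun 'I_r -> 'I_m} * {ffun 'I_r -> 'I_n} -> R,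
    x = \sum_(fg : {ffun 'I_r -> 'I_m} * {ffun 'I_r -> 'I_n})
          cf fg * \det (mxsub fg.1 fg.2 M).

(* image in k[x_1..x_c] = R / nR of an ideal J of R; R is presented as
   a quotient of P via rho, and P -> k[x] is map_mpoly pi *)
Definition bar_ideal (Q : comNzRingType) (c : nat) (R : comNzRingType) (k : fieldType)
    (rho : {mpoly Q[c]} -> R) (pi : Q -> k) (J : R -> Prop) (q : {mpoly k[c]}) : Prop :=
  exists p : {mpoly Q[c]}, J (rho p) /\ q = map_mpoly pi p.

Definition in_zero_locus (k : fieldType) (c : nat) (J : {mpoly k[c]} -> Prop)
    (alpha : 'I_c -> k) : Prop :=
  forall p : {mpoly k[c]}, J p -> (exists d, homog_deg d p) -> p.@[alpha] = 0.

(* Main.v *)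
Require Import Defs.
From HB Require Import structures.
From mathcomp Require Import all_boot all_order all_algebra.
From mathcomp Require Import fraction perm.
From mathcomp Require Import mpoly.
From Stdlib Require Import ClassicalEpsilon.
Import GRing.Theory.
Local Open Scope ring_scope.
Set Implicit Arguments.
Unset Strict Implicit.
Unset Printing Implicit Defensive.

(** Evaluation at [alpha] factors through [R] and has kernel containing the ideal
    [J = (x_i - a_i)].

    If [C_alpha] is contractible, so is [C] evaluated at [alpha]; hence the ranks of two
    consecutive evaluated differentials add up to [b_n].  Each is at most the generic
    rank, and the generic ranks add up to at most [b_n], so both are attained: some
    maximal minor of each differential survives at [alpha], and the product of the two
    is a homogeneous element of the intersection that does not vanish at [alpha].

    Conversely, let a maximal minor of one differential survive at [alpha].  As [Q] is
    local, it is a unit modulo [J], so that this differential [d] has an inner inverse [G]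
    modulo [J], that is [d G d = d].  The [x_i - a_i] form a regular sequence on [R]: [Q]
    embeds into the domain [R], so [P] is a domain, and the partially evaluated [w] are
    nonzero because [sum a_i f_i] is.  Therefore both [C] and its dual stay exact modulo
    [J], and exactness transports inner inverses to the next differential (and, through
    the dual, to the previous one).  Inner inverses in all degrees give a contraction. *)

(** * Ranks and minors *)

Lemma mxrank_mxsub (K : fieldType) (m n p q : nat) (f : 'I_p -> 'I_m)
    (g : 'I_q -> 'I_n) (M : 'M[K]_(m, n)) : (\rank (mxsub f g M) <= \rank M)%N.
Proof.
have -> : mxsub f g M = (rowsub g (rowsub f M)^T)^T by apply/matrixP=> i j; rewrite !mxE.
rewrite mxrank_tr (leq_trans (mxrankS (rowsub_sub _ _))) // mxrank_tr.
exact: mxrankS (rowsub_sub _ _).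
Qed.

Lemma minor_rank_neq0 (K : fieldType) (m n : nat) (M : 'M[K]_(m, n)) :
  exists (f : {ffun 'I_(\rank M) -> 'I_m}) (g : {ffun 'I_(\rank M) -> 'I_n}),
    \det (mxsub f g M) != 0.
Proof.
set f := maxrankfun M.
have full : row_full (rowsub f M)^T.
  by rewrite /row_full mxrank_tr; exact: maxrowsub_free.
exists f, (fullrankfun full).
have := fullrowsub_unit full; rewrite unitmxE unitfE -det_tr.
by congr (\det _ != 0); apply/matrixP=> i j; rewrite !mxE.
Qed.

Lemma det_minor_eq0 (R : idomainType) (m n r : nat) (M : 'M[R]_(m, n))
    (f : 'I_r -> 'I_m) (g : 'I_r -> 'I_n) :
  (rank_frac M < r)%N -> \det (mxsub f g M) = 0.
Proof.
move=> ltMr; apply/eqP; apply: contraTT ltMr => nz; rewrite -leqNgt.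
apply: leq_trans (mxrank_mxsub f g (map_mx (@tofrac R) M)).
rewrite -map_mxsub mxrank_unit // unitmxE unitfE det_map_mx.
by rewrite tofrac_eq0.
Qed.

(** Minors larger than the generic rank vanish in [R], hence also after specialization. *)
Lemma rank_map_le_rank_frac (R : idomainType) (K : fieldType) (ev : {rmorphism R -> K})
    (m n : nat) (M : 'M[R]_(m, n)) : (\rank (map_mx ev M) <= rank_frac M)%N.
Proof.
rewrite leqNgt; apply/negP => lt.
have [f [g]] := minor_rank_neq0 (map_mx ev M).
by rewrite -map_mxsub det_map_mx (det_minor_eq0 f g lt) rmorph0 eqxx.
Qed.

Lemma rank_frac_complex (R : idomainType) (m n p : nat) (A : 'M[R]_(m, n)) (B : 'M[R]_(n, p)) :
  A *m B = 0 -> (rank_frac A + rank_frac B <= n)%N.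
Proof. by move=> AB; apply: mulmx0_rank_max; rewrite -map_mxM AB map_mx0. Qed.

(* Over the fraction field, a nonzero maximal minor [D] makes the rows [f] span
   the row space of [M]; solving for the coefficients on the columns [g] gives
   [M = M_g D^-1 M_f]. *)
Lemma minor_inner_inverse (R : idomainType) (m n : nat) (M : 'M[R]_(m, n))
    (f : 'I_(rank_frac M) -> 'I_m) (g : 'I_(rank_frac M) -> 'I_n) :
  exists G : 'M[R]_(n, m), \det (mxsub f g M) *: M = M *m G *m M.
Proof.
set D := mxsub f g M.
have [D0|Dn0] := eqVneq (\det D) 0.
  by exists 0; rewrite D0 scale0r mulmx0 mul0mx.
exists (colsub g 1%:M *m \adj D *m rowsub f 1%:M).
have -> : M *m (colsub g 1%:M *m \adj D *m rowsub f 1%:M) *m M =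
          colsub g M *m \adj D *m rowsub f M.
  have -> : colsub g M = M *m colsub g 1%:M by rewrite mulmx_colsub mulmx1.
  by rewrite [rowsub f M]rowsubE !mulmxA.
pose F := @tofrac R; set MK := map_mx F M.
have DK : \rank (mxsub f g MK) = \rank MK.
  by rewrite -map_mxsub mxrank_unit // unitmxE unitfE det_map_mx tofrac_eq0.
have [X MX] : exists X, MK = X *m rowsub f MK.
  apply/submxP; rewrite -(geq_leqif (mxrank_leqif_sup (rowsub_sub f MK))).
  rewrite -DK; have -> : mxsub f g MK = mxsub id g (rowsub f MK).
    by apply/matrixP=> i j; rewrite !mxE.
  exact: mxrank_mxsub.
have XD : colsub g MK = X *m map_mx F D.
  rewrite {1}MX map_mxsub -/MK; apply/matrixP=> i j; rewrite !mxE.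
  by apply: eq_bigr => l _; rewrite !mxE.
have injF : injective (fun N : 'M_(m, n) => map_mx F N).
  move=> N1 N2 /matrixP eqN; apply/matrixP=> i j; apply/eqP.
  by have := eqN i j; rewrite !mxE /F => /eqP; rewrite tofrac_eq.
apply: injF => /=.
have -> : map_mx F (colsub g M *m \adj D *m rowsub f M) =
          colsub g MK *m \adj (map_mx F D) *m rowsub f MK.
  by rewrite !map_mxM map_mx_adj; congr (_ *m \adj _ *m _); apply/matrixP=> i j; rewrite !mxE.
by rewrite XD -(mulmxA X) mul_mx_adj mul_mx_scalar -scalemxAl -MX map_mxZ det_map_mx.
Qed.

(** * Exactness and inner inverses modulo an ideal *)

Definition mx_in (R : comNzRingType) (J : R -> Prop) (m n : nat) (M : 'M[R]_(m, n)) : Prop :=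
  forall i j, J (M i j).

(** All data are lifts to [R]. Test matrices with any number of columns, instead of vectors, let it
    apply directly to [1 - G A]. *)
Definition exact_mod (R : comNzRingType) (J : R -> Prop) (m n p : nat)
    (A : 'M[R]_(m, n)) (B : 'M[R]_(n, p)) : Prop :=
  forall q (V : 'M[R]_(n, q)), mx_in J (A *m V) -> exists U, mx_in J (V - B *m U).

(** Von Neumann regularity over [R/J]: kernel and image of [M] are direct summands there. *)
Definition inner_inverse_mod (R : comNzRingType) (J : R -> Prop) (m n : nat)
    (M : 'M[R]_(m, n)) (G : 'M[R]_(n, m)) : Prop :=
  mx_in J (M *m G *m M - M).

Section Ideals.

Variables (R : comNzRingType) (J : R -> Prop).
Hypothesis idJ : is_ideal J.

Lemma ideal0 : J 0. Proof. by case: idJ. Qed.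

Lemma idealD x y : J x -> J y -> J (x + y). Proof. by case: idJ => _ [+ _]; exact. Qed.

Lemma idealMl a x : J x -> J (a * x). Proof. by case: idJ => _ [_]; exact. Qed.

Lemma idealN x : J x -> J (- x). Proof. by rewrite -mulN1r; exact: idealMl. Qed.

Lemma idealB x y : J x -> J y -> J (x - y).
Proof. by move=> Jx Jy; apply: idealD => //; exact: idealN. Qed.

Lemma ideal_sum (I : Type) (r : seq I) (P : pred I) (F : I -> R) :
  (forall i, P i -> J (F i)) -> J (\sum_(i <- r | P i) F i).
Proof. by move=> JF; elim/big_ind: _ => //; [exact: ideal0 | exact: idealD]. Qed.

Lemma mx_inD m n (M N : 'M[R]_(m, n)) : mx_in J M -> mx_in J N -> mx_in J (M + N).
Proof. by move=> JM JN i j; rewrite mxE; exact: idealD. Qed.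

Lemma mx_inN m n (M : 'M[R]_(m, n)) : mx_in J M -> mx_in J (- M).
Proof. by move=> JM i j; rewrite mxE; exact: idealN. Qed.

Lemma mx_in_mull m n p (A : 'M[R]_(m, n)) (M : 'M[R]_(n, p)) :
  mx_in J M -> mx_in J (A *m M).
Proof. by move=> JM i j; rewrite mxE; apply: ideal_sum => l _; exact: idealMl. Qed.

Lemma mx_in_mulr m n p (M : 'M[R]_(m, n)) (A : 'M[R]_(n, p)) :
  mx_in J M -> mx_in J (M *m A).
Proof.
by move=> JM i j; rewrite mxE; apply: ideal_sum => l _; rewrite mulrC; exact: idealMl.
Qed.

(* If [V] lifts a cycle of the quotient by [x], then [B V = x W] mod [J], and regularity
   of [x] makes [W] a cycle mod [J]. *)
Lemma exact_mod_regular (J' : R -> Prop) (x : R) (m n p q : nat)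
    (A : 'M[R]_(m, n)) (B : 'M[R]_(n, p)) (C : 'M[R]_(p, q)) :
  (forall y, J (x * y) -> J y) -> (forall y, J' y <-> exists u, J (y - x * u)) ->
  A *m B = 0 -> exact_mod J A B -> exact_mod J B C -> exact_mod J' B C.
Proof.
move=> regx J'P AB exAB exBC s V BV.
have /choice [Y YP] : forall ij, exists u, J ((B *m V) ij.1 ij.2 - x * u).
  by move=> ij; apply/J'P; exact: BV.
pose W := \matrix_(i, j) Y (i, j).
have BVW : mx_in J (B *m V - x *: W).
  by move=> i j; rewrite !mxE; have := YP (i, j); rewrite /= mxE.
have AW : mx_in J (A *m W).
  move=> i j; apply: regx.
  have := idealN (mx_in_mull A BVW i j).
  by rewrite mulmxBr mulmxA AB mul0mx sub0r mxE opprK -scalemxAr mxE.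
have [Z WZ] := exAB _ _ AW.
have BVZ : mx_in J (B *m (V - x *: Z)).
  have -> : B *m (V - x *: Z) = (B *m V - x *: W) + x%:M *m (W - B *m Z).
    by rewrite mulmxBr -scalemxAr mul_scalar_mx scalerBr addrA subrK.
  by apply: mx_inD => //; exact: mx_in_mull.
have [U VU] := exBC _ _ BVZ.
exists U => i j; apply/J'P; exists (Z i j).
by have := VU i j; rewrite !mxE addrAC.
Qed.

(** The columns of [1 - G A] are cycles modulo [J], so it is congruent to some [B H]; multiply on
    the right by [B] and use [A B = 0]. *)
Lemma inner_inverse_mod_exact m n p (A : 'M[R]_(m, n)) (B : 'M[R]_(n, p)) G :
  A *m B = 0 -> exact_mod J A B -> inner_inverse_mod J A G ->
  exists H, inner_inverse_mod J B H.
Proof.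
move=> AB exAB AG.
have [|H HP] := exAB _ (1%:M - G *m A).
  by rewrite mulmxBr mulmx1 mulmxA -opprB; exact: mx_inN.
exists H; rewrite /inner_inverse_mod.
have -> : B *m H *m B - B = - ((1%:M - G *m A - B *m H) *m B).
  by rewrite !mulmxBl mul1mx -(mulmxA G) AB mulmx0 subr0 opprB.
exact/mx_inN/mx_in_mulr.
Qed.

Lemma inner_inverse_mod_tr m n (M : 'M[R]_(m, n)) G :
  inner_inverse_mod J M G -> inner_inverse_mod J M^T G^T.
Proof.
move=> MG i j; have := MG j i; rewrite !mxE; congr (J (_ - _)).
have := congr1 (fun N : 'M_(m, n) => N^T i j) (erefl (M *m G *m M)).
by rewrite {1}mxE [in RHS]trmx_mul [in RHS]trmx_mul mulmxA mxE => ->; rewrite mxE.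
Qed.

End Ideals.

(** * Complexes indexed by all integers *)

Lemma int_shift (P : int -> Prop) : (forall n, P (n + 1)) -> forall n, P n.
Proof. by move=> Psh n; rewrite -(subrK 1 n). Qed.

Lemma int_ind_updown (P : int -> Prop) (m : int) :
  P m -> (forall n, P n -> P (n + 1)) -> (forall n, P (n + 1) -> P n) ->
  forall n, P n.
Proof.
move=> Pm Pup Pdown n; suff PmD d : P (m + d) by rewrite -(subrK m n) addrC.
elim: d => [|d IH|d IH]; first by rewrite addr0.
  by rewrite -addn1 PoszD addrA; exact: Pup.
by apply: Pdown; rewrite -addn1 PoszD opprD -addrA subrK.
Qed.

Section Complexes.

Variables (R : comNzRingType) (b : int -> nat) (dd : forall n : int, 'M[R]_(b n, b (n + 1))).
Hypothesis dd_complex : is_complex dd.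

Lemma acyclic_exact_mod (J : R -> Prop) :
  (forall y, J y <-> y = 0) -> acyclic dd ->
  forall n, exact_mod J (dd n) (dd (n + 1)).
Proof.
move=> J0 ac n q V dV.
have /choice [u uP] : forall j, exists u : 'cV_(b (n + 1 + 1)), col j V = dd (n + 1) *m u.
  move=> j; apply: ac; apply/matrixP=> i l; rewrite [RHS]mxE; apply/J0.
  have := dV i j; rewrite !mxE; congr J.
  by apply: eq_bigr => t _; rewrite !mxE.
exists (\matrix_(i, j) u j i 0) => i j; apply/J0/eqP.
rewrite !mxE subr_eq0; apply/eqP.
have /matrixP/(_ i 0) := uP j; rewrite !mxE => ->.
by apply: eq_bigr => l _; rewrite mxE.
Qed.

Lemma dual_acyclic_exact_mod (J : R -> Prop) :
  (forall y, J y <-> y = 0) -> dual_acyclic dd ->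
  forall n, exact_mod J (dd (n + 1))^T (dd n)^T.
Proof.
move=> J0 ac n q V dV.
have /choice [u uP] : forall j, exists u : 'rV_(b n), row j V^T = u *m dd n.
  move=> j; apply: ac; apply/matrixP=> i l; rewrite [RHS]mxE; apply/J0.
  have := dV l j; rewrite !mxE; congr J.
  by apply: eq_bigr => t _; rewrite !mxE mulrC.
exists (\matrix_(i, j) u j 0 i) => i j; apply/J0/eqP.
rewrite !mxE subr_eq0; apply/eqP.
have /matrixP/(_ 0 i) := uP j; rewrite !mxE => ->.
by apply: eq_bigr => l _; rewrite !mxE mulrC.
Qed.

(** Passing from [J i] to [J i.+1] consumes exactness in one neighbouring degree, so the induction
    on [i] carries all [n] at once. *)
Lemma exact_mod_regular_seq (c : nat) (J : nat -> R -> Prop) (x : 'I_c -> R) :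
  (forall i, is_ideal (J i)) ->
  (forall (i : 'I_c) y, J i (x i * y) -> J i y) ->
  (forall (i : 'I_c) y, J i.+1 y <-> exists u, J i (y - x i * u)) ->
  (forall n, exact_mod (J 0%N) (dd n) (dd (n + 1))) ->
  (forall n, exact_mod (J 0%N) (dd (n + 1))^T (dd n)^T) ->
  (forall n, exact_mod (J c) (dd n) (dd (n + 1))) /\
  (forall n, exact_mod (J c) (dd (n + 1))^T (dd n)^T).
Proof.
move=> idJ regx JS ex0 exT0; move: (leqnn c); move: {-2}c.
elim=> [//|i IH] lt_ic; have [ex exT] := IH (ltnW lt_ic); split.
  apply: int_shift => n.
  exact: (exact_mod_regular (idJ i) (regx (Ordinal lt_ic)) (JS (Ordinal lt_ic)) (dd_complex n)).
move=> n.
apply: (exact_mod_regular (idJ i) (regx (Ordinal lt_ic)) (JS (Ordinal lt_ic)) _ (exT (n + 1))) => //.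
by rewrite -trmx_mul dd_complex trmx0.
Qed.

(** Exactness moves an inner inverse from [dd n] to [dd (n + 1)]; exactness of the transposes moves
    it back. *)
Lemma inner_inverse_mod_all (J : R -> Prop) (m : int) :
  is_ideal J ->
  (forall n, exact_mod J (dd n) (dd (n + 1))) ->
  (forall n, exact_mod J (dd (n + 1))^T (dd n)^T) ->
  (exists G, inner_inverse_mod J (dd m) G) ->
  forall n, exists G, inner_inverse_mod J (dd n) G.
Proof.
move=> idJ ex exT; move/(int_ind_updown (P := fun n => exists G, inner_inverse_mod J (dd n) G)).
apply=> n [G GP].
  exact: (inner_inverse_mod_exact idJ (dd_complex n) (ex n) GP).
have dT : (dd (n + 1))^T *m (dd n)^T = 0 by rewrite -trmx_mul dd_complex trmx0.
have [H /inner_inverse_mod_tr HP] :=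
  inner_inverse_mod_exact idJ dT (exT n) (inner_inverse_mod_tr GP).
by exists H^T; rewrite -[dd n]trmxK.
Qed.

Lemma inner_inverse_mod_contraction (J : R -> Prop) :
  is_ideal J ->
  (forall n, exact_mod J (dd n) (dd (n + 1))) ->
  (forall n, exists G, inner_inverse_mod J (dd n) G) ->
  exists s : forall n : int, 'M[R]_(b (n + 1), b n),
    forall n, mx_in J (dd (n + 1) *m s (n + 1) + s n *m dd n - 1%:M).
Proof.
move=> idJ ex exG.
pose g n := proj1_sig (constructive_indefinite_description _ (exG n)).
have gP n : inner_inverse_mod J (dd n) (g n).
  by rewrite /g; case: constructive_indefinite_description.
(* With [P = d g] the projection onto the boundaries, the correction [(1 - P) g]
   of [g] gives [d s + s d = P + (1 - P) g d], and [1 - g d] has image in that of [P]. *)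
exists (fun n => (1%:M - dd (n + 1) *m g (n + 1)) *m g n) => n.
set P := dd (n + 1) *m g (n + 1).
have -> : dd (n + 1) *m ((1%:M - dd (n + 1 + 1) *m g (n + 1 + 1)) *m g (n + 1)) = P.
  by rewrite mulmxA mulmxBr mulmx1 mulmxA dd_complex mul0mx subr0.
have -> : P + (1%:M - P) *m g n *m dd n - 1%:M = - ((1%:M - P) *m (1%:M - g n *m dd n)).
  by rewrite mulmxBr mulmx1 mulmxA !opprB [P + _]addrC addrA.
apply: mx_inN => //.
have [|U UP] := ex n _ (1%:M - g n *m dd n).
  by rewrite mulmxBr mulmx1 mulmxA -opprB; apply: mx_inN => //; exact: gP.
rewrite -(subrK (dd (n + 1) *m U) (1%:M - g n *m dd n)) mulmxDr.
apply: mx_inD => //; first exact: mx_in_mull.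
rewrite mulmxA; apply: mx_in_mulr => //; rewrite mulmxBl mul1mx -opprB.
by apply: mx_inN => //; exact: gP.
Qed.

End Complexes.

(** * Ideals of initial segments of a sequence *)

Lemma big_ord_ltS (V : nmodType) (c : nat) (i : 'I_c) (F : 'I_c -> V) :
  \sum_(j < c | (j < i.+1)%N) F j = F i + \sum_(j < c | (j < i)%N) F j.
Proof.
rewrite (bigD1 i) //=; congr (_ + _); apply: eq_bigl => j.
by rewrite ltnS [in RHS]ltn_neqAle andbC.
Qed.

(** Same form as in [regular_seq]; [i] is a natural number so that 0 and [c] give the zero ideal and
    the whole ideal. *)
Definition ideal_below (A : comNzRingType) (c : nat) (g : 'I_c -> A) (i : nat) (y : A) : Prop :=
  exists r : 'I_c -> A, y = \sum_(j < c | (j < i)%N) r j * g j.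

Section IdealBelow.

Variables (A : comNzRingType) (c : nat) (g : 'I_c -> A).

Lemma ideal_below_ideal i : is_ideal (ideal_below g i).
Proof.
split; last split.
- by exists (fun=> 0); rewrite big1 // => j _; rewrite mul0r.
- move=> x y [r ->] [s ->]; exists (fun j => r j + s j).
  by rewrite -big_split; apply: eq_bigr => j _; rewrite mulrDl.
- move=> a x [r ->]; exists (fun j => a * r j).
  by rewrite mulr_sumr; apply: eq_bigr => j _; rewrite mulrA.
Qed.

Lemma ideal_below_gen i (j : 'I_c) : (j < i)%N -> ideal_below g i (g j).
Proof.
move=> ltji; exists (fun l => (l == j)%:R).
rewrite (bigD1 j) //= eqxx mul1r big1 ?addr0 // => l /andP[_ /negPf ->].
by rewrite mul0r.
Qed.

Lemma ideal_belowS (i : 'I_c) y :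
  ideal_below g i.+1 y <-> exists u, ideal_below g i (y - g i * u).
Proof.
split=> [[r ->]|[u [r yE]]].
  by exists (r i), r; rewrite big_ord_ltS addrC mulrC addrK.
exists (fun j => if j == i then u else r j).
rewrite big_ord_ltS eqxx -[LHS](subrK (g i * u)) yE addrC mulrC; congr (_ + _).
by apply: eq_bigr => j ltji; case: eqP ltji => // ->; rewrite ltnn.
Qed.

Lemma ideal_below0 y : ideal_below g 0 y <-> y = 0.
Proof.
by split=> [[r ->]|->]; [rewrite big_pred0 | exists (fun=> 0); rewrite big_pred0].
Qed.

Lemma ideal_below_all y : ideal_below g c y <-> ideal_gen g y.
Proof.
by split=> -[r ->]; exists r; [apply: eq_bigl | apply/esym/eq_bigl] => j; rewrite ltn_ord.
Qed.

End IdealBelow.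

Lemma ideal_below_map (A B : comNzRingType) (h : {rmorphism A -> B}) (c i : nat)
    (g : 'I_c -> A) (x : A) :
  ideal_below g i x -> ideal_below (fun j => h (g j)) i (h x).
Proof.
move=> [r ->]; exists (fun j => h (r j)).
by rewrite rmorph_sum; apply: eq_bigr => j _; rewrite rmorphM.
Qed.

(** Congruence modulo [I] respects sums and products, and constants and variables generate. With
    [h1] the identity this yields remainder theorems; with [I] zero, equality of morphisms. *)
Lemma mpoly_rmorph_cong (Q A : comNzRingType) (c : nat)
    (h1 h2 : {rmorphism {mpoly Q[c]} -> A}) (I : A -> Prop) :
  is_ideal I -> (forall q, I (h1 q%:MP - h2 q%:MP)) ->
  (forall i, I (h1 'X_i - h2 'X_i)) -> forall p, I (h1 p - h2 p).
Proof.
move=> idI hC hX p.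
have hM x y : I (h1 x - h2 x) -> I (h1 y - h2 y) -> I (h1 (x * y) - h2 (x * y)).
  move=> Ix Iy; rewrite !rmorphM.
  have -> : h1 x * h1 y - h2 x * h2 y = h1 y * (h1 x - h2 x) + h2 x * (h1 y - h2 y).
    by rewrite !mulrBr ![h1 y * _]mulrC addrA subrK.
  by apply: (idealD idI); exact: (idealMl idI).
have h0 : I (h1 1 - h2 1) by rewrite !rmorph1 subrr; exact: ideal0.
rewrite (mpolyE p) !rmorph_sum -sumrB; apply: (ideal_sum idI) => m _.
rewrite -mul_mpolyC; apply: (hM) => //; rewrite mpolyXE_id.
apply: (big_ind (fun x => I (h1 x - h2 x))) => [//|x y|i _]; first exact: hM.
elim: (m i) => [|d IH]; first by rewrite expr0.
by rewrite exprS; exact: hM.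
Qed.

(** * Partial evaluation and regular sequences *)

Definition eval_below (Q : comNzRingType) (c : nat) (a : 'I_c -> Q) (i : nat) :
    {mpoly Q[c]} -> {mpoly Q[c]} :=
  mmap (@mpolyC c Q) (fun j => if (j < i)%N then (a j)%:MP else 'X_j).

HB.instance Definition _ (Q : comNzRingType) (c : nat) (a : 'I_c -> Q) (i : nat) :=
  GRing.RMorphism.on (eval_below a i).

Section EvalBelow.

Variables (Q : comNzRingType) (c : nat) (a : 'I_c -> Q).

Local Notation g := (fun j : 'I_c => 'X_j - (a j)%:MP : {mpoly Q[c]}).

Lemma eval_belowC i q : eval_below a i q%:MP = q%:MP.
Proof. exact: mmapC. Qed.

Lemma eval_belowX i j :
  eval_below a i 'X_j = if (j < i)%N then (a j)%:MP else 'X_j.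
Proof. by rewrite /eval_below mmapX mmap1U. Qed.

Lemma sub_eval_below i p : ideal_below g i (p - eval_below a i p).
Proof.
apply: (mpoly_rmorph_cong (h1 := idfun) (h2 := eval_below a i)).
- exact: ideal_below_ideal.
- by move=> q; rewrite /= eval_belowC subrr; exact: ideal0 (ideal_below_ideal _ _).
move=> j; rewrite /= eval_belowX; case: ifP => ltji; first exact: (ideal_below_gen g).
by rewrite subrr; exact: ideal0 (ideal_below_ideal _ _).
Qed.

(** With [sub_eval_below], this identifies the kernel of [eval_below a i] as the ideal of the first
    [i] elements. *)
Lemma eval_below_eq0 i i' p : (i <= i')%N -> ideal_below g i p -> eval_below a i' p = 0.
Proof.
move=> le_ii' [r ->]; rewrite rmorph_sum big1 // => j ltji.
by rewrite rmorphM rmorphB /= eval_belowC eval_belowX (leq_trans ltji) // subrr mulr0.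
Qed.

Lemma eval_below_comp i i' p :
  (i <= i')%N -> eval_below a i' (eval_below a i p) = eval_below a i' p.
Proof.
move=> le_ii'; apply/eqP; rewrite eq_sym -subr_eq0 -rmorphB.
by rewrite /= (eval_below_eq0 le_ii') //; exact: sub_eval_below.
Qed.

Lemma sub_meval p : ideal_below g c (p - (p.@[a])%:MP).
Proof.
apply: (mpoly_rmorph_cong (h1 := idfun) (h2 := @mpolyC c Q \o meval a)).
- exact: ideal_below_ideal.
- by move=> q; rewrite /= mevalC subrr; exact: ideal0 (ideal_below_ideal _ _).
by move=> j; rewrite /= mevalXU; exact: (ideal_below_gen g).
Qed.

Lemma eval_below_all p : eval_below a c p = (p.@[a])%:MP.
Proof.
apply/eqP; rewrite -subr_eq0; have := eval_below_eq0 (leqnn c) (sub_meval p).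
by rewrite rmorphB /= eval_belowC => ->.
Qed.

Lemma X_sub_const_neq0 (i : 'I_c) : g i != 0.
Proof.
apply/eqP => /(congr1 (meval (fun=> a i + 1))).
by rewrite mevalB mevalXU mevalC meval0 addrC addKr => /eqP; rewrite oner_eq0.
Qed.

Variables (R : comNzRingType) (rho : {rmorphism {mpoly Q[c]} -> R}) (w : {mpoly Q[c]}).
Hypothesis rho_surj : forall y : R, exists p, rho p = y.
Hypothesis rho_ker : forall p, rho p = 0 <-> exists q, p = w * q.

(* The quotient of [R] by the first [i] elements [x_j - a_j] is the polynomial ring
   in the remaining variables modulo the partially evaluated [w]. *)
Lemma ideal_below_quotient i p :
  ideal_below (fun j => rho (g j)) i (rho p) <->
  exists z, eval_below a i p = eval_below a i w * z.
Proof.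
split=> [[r rhop]|[z pE]].
  have /choice [s sP] : forall j, exists s, rho s = r j by move=> j; exact: rho_surj.
  pose t := \sum_(j < c | (j < i)%N) s j * g j.
  have /rho_ker [q ptE] : rho (p - t) = 0.
    rewrite rmorphB rhop rmorph_sum; apply/eqP; rewrite subr_eq0; apply/eqP.
    by apply: eq_bigr => j _; rewrite rmorphM sP.
  exists (eval_below a i q); rewrite -rmorphM -ptE rmorphB /= (@eval_below_eq0 i i t) ?subr0 //.
  by exists s.
have -> : rho p = rho (p - eval_below a i p - (w - eval_below a i w) * z).
  rewrite pE mulrBl opprB addrA subrK !rmorphB.
  by rewrite (rho_ker (w * z)).2 ?subr0 //; exists z.
apply: ideal_below_map.
have idI := ideal_below_ideal g i.
apply: (idealB idI); first exact: sub_eval_below.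
by rewrite mulrC; apply: (idealMl idI); exact: sub_eval_below.
Qed.

(** Write [w_i], [z_i] for the evaluations of the first [i] variables. From
    [(x_i - a_i) p_i = w_i z_i], setting [x_i = a_i] gives [w_(i+1) z_(i+1) = 0], so [z_(i+1) = 0];
    then [x_i - a_i] divides [z_i] and cancels. *)
Lemma X_sub_const_regular (i : 'I_c) (y : R) :
  (forall p q : {mpoly Q[c]}, p * q = 0 -> p = 0 \/ q = 0) ->
  eval_below a i.+1 w != 0 ->
  ideal_below (fun j => rho (g j)) i (rho (g i) * y) ->
  ideal_below (fun j => rho (g j)) i y.
Proof.
move=> dom w0; have [p <-] := rho_surj y; rewrite -rmorphM => H.
have [z pz] := proj1 (ideal_below_quotient i (g i * p)) H.
apply/ideal_below_quotient; move: pz.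
have gi : eval_below a i (g i) = g i.
  by rewrite rmorphB /= eval_belowC eval_belowX ltnn.
have giS : eval_below a i.+1 (g i) = 0.
  by rewrite (eval_below_eq0 (leqnn _)) //; exact: (ideal_below_gen g).
rewrite rmorphM /= gi => /[dup] pz /(congr1 (eval_below a i)).
rewrite !rmorphM /= gi !eval_below_comp // => pz'.
have wz0 : eval_below a i.+1 w * eval_below a i.+1 z = 0.
  have := congr1 (eval_below a i.+1) pz.
  by rewrite !rmorphM /= giS mul0r eval_below_comp.
case: (dom _ _ wz0) => [/eqP|z0]; first by rewrite (negPf w0).
(* Now [z] lies in the ideal of the first [i + 1] elements; evaluating the first [i] variables
   leaves the single term [(x_i - a_i) u_i]. *)
have := sub_eval_below i.+1 z; rewrite z0 subr0.
move=> /ideal_belowS[u /(eval_below_eq0 (leqnn _))].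
rewrite rmorphB rmorphM /= gi => /subr0_eq zE.
exists (eval_below a i u); apply/subr0_eq.
have gd0 : g i * (eval_below a i p - eval_below a i w * eval_below a i u) = 0.
  by rewrite mulrBr pz' zE mulrCA subrr.
by case: (dom _ _ gd0) => [/eqP|//]; rewrite (negPf (X_sub_const_neq0 i)).
Qed.

End EvalBelow.

(** Regularity puts the last coefficient into the ideal of the earlier [f j], hence into [nn].
    Substituting its expression gives a shorter relation whose coefficients differ from the old ones
    by multiples of [f i]. *)
Lemma regular_seq_syzygy (Q : comNzRingType) (nn : Q -> Prop) (c : nat) (f a : 'I_c -> Q) :
  is_ideal nn -> (forall i, nn (f i)) -> regular_seq f ->
  \sum_(j < c) a j * f j = 0 -> forall j, nn (a j).
Proof.
move=> idn nf [reg _] sum0 j.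
suff H t : (t <= c)%N -> forall a' : 'I_c -> Q,
    \sum_(j < c | (j < t)%N) a' j * f j = 0 -> forall j : 'I_c, (j < t)%N -> nn (a' j).
  apply: (H c) => //; rewrite -[RHS]sum0; apply: eq_bigl => l; exact: ltn_ord.
elim: t => // t IH lt_tc a'; pose i := Ordinal lt_tc.
rewrite (big_ord_ltS i) => /eqP; rewrite addr_eq0 => /eqP aE.
have [|r aiE] := reg i (a' i).
  exists (fun j => - a' j); rewrite mulrC aE -sumrN.
  by apply: eq_bigr => l _; rewrite mulNr.
have nai : nn (a' i).
  by rewrite aiE; apply: (ideal_sum idn) => l _; exact: (idealMl idn).
move=> l; rewrite ltnS leq_eqVlt => /orP[/eqP li|lt_lt].
  by rewrite (_ : l = i) //; exact: val_inj.
have -> : a' l = a' l + r l * f i - r l * f i by rewrite addrK.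
apply: (idealB idn); last exact: (idealMl idn).
apply: (IH (ltnW lt_tc) (fun l => a' l + r l * f i)) lt_lt.
under eq_bigr do rewrite mulrDl mulrAC.
rewrite big_split /= -mulr_suml; apply/eqP; rewrite addr_eq0 -[X in X * _]aiE aE.
by rewrite opprK.
Qed.

Lemma rmorphism_lift (A B C : comNzRingType) (h : {rmorphism A -> B}) (u : {rmorphism A -> C}) :
  (forall y, exists x, h x = y) -> (forall x, h x = 0 -> u x = 0) ->
  exists v : {rmorphism B -> C}, forall x, v (h x) = u x.
Proof.
move=> /choice [s sP] ker_h; pose v y := u (s y).
have vP x : v (h x) = u x.
  by apply/subr0_eq; rewrite -rmorphB ker_h // rmorphB sP subrr.
have vB : zmod_morphism v.
  by move=> x y; rewrite -{1}(sP x) -{1}(sP y) -rmorphB vP rmorphB.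
have vM : monoid_morphism v.
  split=> [|x y]; first by rewrite -(rmorph1 h) vP rmorph1.
  by rewrite -{1}(sP x) -{1}(sP y) -rmorphM vP rmorphM.
pose vBm := GRing.isZmodMorphism.Build B C v vB.
pose vMm := GRing.isMonoidMorphism.Build B C v vM.
pose V : {rmorphism B -> C} := HB.pack v vBm vMm.
by exists V.
Qed.

(** * Homogeneous elements and determinants *)

Section Homogeneous.

Variables (Q : comNzRingType) (c : nat) (R : comNzRingType) (rho : {rmorphism {mpoly Q[c]} -> R}).

Lemma homog_degE d (p : {mpoly Q[c]}) : homog_deg d p = (p \is d.-homog).
Proof. by rewrite dhomogE. Qed.

Lemma homogR0 d : homogR rho d 0.
Proof. by case: d => // d; exists 0; rewrite homog_degE dhomog0 rmorph0. Qed.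

Lemma homogRD d x y : homogR rho d x -> homogR rho d y -> homogR rho d (x + y).
Proof.
case: d => d /=; last by move=> -> ->; rewrite addr0.
move=> [p [hp <-]] [q [hq <-]]; exists (p + q); rewrite rmorphD; split=> //.
by move: hp hq; rewrite !homog_degE; exact: dhomogD.
Qed.

Lemma homogRN d x : homogR rho d x -> homogR rho d (- x).
Proof.
case: d => d /=; last by move=> ->; rewrite oppr0.
move=> [p [hp <-]]; exists (- p); rewrite rmorphN; split=> //.
by move: hp; rewrite !homog_degE => hp; rewrite rpredN.
Qed.

Lemma homogR1 : homogR rho 0 1.
Proof. by exists 1; rewrite homog_degE dhomog1 rmorph1. Qed.

Lemma homogRM d d' x y : homogR rho d x -> homogR rho d' y -> homogR rho (d + d') (x * y).
Proof.
case: d => [d|d]; last by move=> -> _; rewrite mul0r; exact: homogR0.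
case: d' => [d'|d']; last by move=> _ ->; rewrite mulr0; exact: homogR0.
move=> [p [hp <-]] [q [hq <-]]; exists (p * q); rewrite rmorphM; split=> //.
by move: hp hq; rewrite !homog_degE => hp hq; apply: dhomogM.
Qed.

Lemma homogR_det r (M : 'M[R]_r) (e e' : 'I_r -> int) :
  (forall i j, homogR rho (e' j - e i) (M i j)) ->
  homogR rho (\sum_j e' j - \sum_i e i) (\det M).
Proof.
move=> hM; rewrite /determinant.
apply: (big_ind (homogR rho (\sum_j e' j - \sum_i e i))) => [|x y|s _];
  [exact: homogR0 | exact: homogRD|].
suff hp : homogR rho (\sum_j e' j - \sum_i e i) (\prod_i M i (s i)).
  by case: (odd_perm s); rewrite ?expr1 ?expr0 ?mul1r ?mulN1r //; exact: homogRN.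
(* Reindexing the column degrees by [s] turns the total degree into the sum of the degrees of the
   chosen entries. *)
rewrite (reindex_inj (@perm_inj _ s)) -sumrB /=.
by apply: (big_rec2 (fun d x => homogR rho d x)) => [|i d x _ hx]; [exact: homogR1 | exact: homogRM].
Qed.

End Homogeneous.

(** * Constants, reduction to [k], and surviving minors *)

Lemma minor_ideal_minor (R : comNzRingType) (m n r : nat) (M : 'M[R]_(m, n))
    (f : {ffun 'I_r -> 'I_m}) (g : {ffun 'I_r -> 'I_n}) (y : R) :
  minor_ideal r M (y * \det (mxsub f g M)).
Proof.
exists (fun fg => if fg == (f, g) then y else 0).
rewrite (bigD1 (f, g)) //= eqxx big1 ?addr0 // => fg /negPf ->.
by rewrite mul0r.
Qed.

(** Evaluate at the origin, where [wpoly f] vanishes. Thus [Q] embeds into [R]. *)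
Lemma wpoly_quotient_constant_eq0 (Q : comNzRingType) (c : nat) (f : 'I_c -> Q)
    (R : comNzRingType) (rho : {rmorphism {mpoly Q[c]} -> R}) (q : Q) :
  (forall p, rho p = 0 <-> exists q, p = wpoly f * q) -> rho q%:MP = 0 -> q = 0.
Proof.
move=> rho_ker /rho_ker [z] /(congr1 (meval (fun=> 0))).
rewrite mevalC mevalM => ->; rewrite [X in X * _](_ : _ = 0) ?mul0r //.
rewrite /wpoly raddf_sum big1 // => i _ /=.
by rewrite mevalM mevalXU mulr0.
Qed.

Lemma mpoly_domain (Q : comNzRingType) (R : idomainType) (h : {rmorphism Q -> R}) (c : nat)
    (p q : {mpoly Q[c]}) :
  (forall x, h x = 0 -> x = 0) -> p * q = 0 -> p = 0 \/ q = 0.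
Proof.
move=> ker_h pq0.
have inj0 (r : {mpoly Q[c]}) : map_mpoly h r = 0 -> r = 0.
  move=> r0; apply/mpolyP=> m; rewrite mcoeff0; apply: ker_h.
  by rewrite -mcoeff_map_mpoly r0 mcoeff0.
have := congr1 (map_mpoly h) pq0; rewrite rmorphM rmorph0 => /eqP.
by rewrite mulf_eq0 => /orP[] /eqP /inj0; [left | right].
Qed.

Lemma meval_map_mpoly (Q k : comNzRingType) (pi : {rmorphism Q -> k}) (c : nat)
    (a : 'I_c -> Q) (p : {mpoly Q[c]}) :
  (map_mpoly pi p).@[fun i => pi (a i)] = pi p.@[a].
Proof.
have eq0 : is_ideal (fun x : k => x = 0).
  by split=> //; split=> [x y -> ->|x y ->]; rewrite ?addr0 ?mulr0.
apply/subr0_eq; apply: (mpoly_rmorph_cong (h1 := meval (fun i => pi (a i)) \o map_mpoly pi)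
  (h2 := pi \o meval a) eq0) => [q|i] /=.
  by rewrite map_mpolyC !mevalC subrr.
by rewrite map_mpolyX !mevalXU subrr.
Qed.

Lemma homog_deg_map (Q k : comNzRingType) (pi : {rmorphism Q -> k}) (c d : nat)
    (p : {mpoly Q[c]}) : homog_deg d p -> homog_deg d (map_mpoly pi p).
Proof.
move=> /allP hp; apply/allP => m; rewrite mcoeff_msupp mcoeff_map_mpoly => pm.
apply: hp; rewrite mcoeff_msupp; apply: contraNneq pm => pm0; apply/eqP.
by rewrite pm0; exact: rmorph0.
Qed.

(** Nonvanishing rules out negative degrees, where [homogR] allows only 0. *)
Lemma homog_deg_minor (Q : comNzRingType) (c : nat) (R : comNzRingType)
    (rho : {rmorphism {mpoly Q[c]} -> R}) (m n r : nat) (M : 'M[R]_(m, n))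
    (e : 'I_m -> int) (e' : 'I_n -> int) (f : 'I_r -> 'I_m) (g : 'I_r -> 'I_n) :
  (forall i j, homogR rho (e' j - e i) (M i j)) -> \det (mxsub f g M) != 0 ->
  exists d p, homog_deg d p /\ rho p = \det (mxsub f g M).
Proof.
move=> hM nz.
have : homogR rho (\sum_j e' (g j) - \sum_i e (f i)) (\det (mxsub f g M)).
  by apply: homogR_det => i j; rewrite mxE; exact: hM.
case: (_ - _) => d /=; first by move=> hp; exists d.
by move=> eq0; rewrite eq0 eqxx in nz.
Qed.

Lemma minor_neq0_of_rank (R : idomainType) (k : fieldType) (ev : {rmorphism R -> k})
    (m n : nat) (M : 'M[R]_(m, n)) :
  \rank (map_mx ev M) = rank_frac M ->
  exists (f : {ffun 'I_(rank_frac M) -> 'I_m}) (g : {ffun 'I_(rank_frac M) -> 'I_n}),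
    ev (\det (mxsub f g M)) != 0.
Proof.
move=> rkM; have := minor_rank_neq0 (map_mx ev M); rewrite rkM => -[f [g nz]].
by exists f, g; rewrite -det_map_mx map_mxsub.
Qed.

Lemma minor_neq0_of_ideal (R k : comNzRingType) (ev : {rmorphism R -> k})
    (m n r : nat) (M : 'M[R]_(m, n)) (x : R) :
  minor_ideal r M x -> ev x != 0 ->
  exists (f : {ffun 'I_r -> 'I_m}) (g : {ffun 'I_r -> 'I_n}), ev (\det (mxsub f g M)) != 0.
Proof.
move=> [cf ->]; rewrite rmorph_sum => nz.
have [[f g] /= fg0|all0] :=
  pickP (fun fg : {ffun 'I_r -> 'I_m} * {ffun 'I_r -> 'I_n} => ev (\det (mxsub fg.1 fg.2 M)) != 0).
  by exists f, g.
rewrite big1 ?eqxx // in nz => fg _.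
by rewrite rmorphM; have /negbFE /eqP -> := all0 fg; rewrite mulr0.
Qed.

Lemma rank_contraction (k : fieldType) (m n p : nat) (A : 'M[k]_(m, n)) (B : 'M[k]_(n, p)) S T :
  B *m S + T *m A = 1%:M -> (n <= \rank A + \rank B)%N.
Proof.
move=> eq1; rewrite -{1}(mxrank1 k n) -eq1 addnC.
by apply: leq_trans (mxrank_add _ _) _; apply: leq_add; [exact: mxrankM_maxl | exact: mxrankM_maxr].
Qed.

(** As [t] inverts the minor modulo [J], it clears the factor in [minor_inner_inverse]. *)
Lemma inner_inverse_of_unit_minor (R : idomainType) (J : R -> Prop) (m n : nat)
    (M : 'M[R]_(m, n)) (f : 'I_(rank_frac M) -> 'I_m) (g : 'I_(rank_frac M) -> 'I_n) (t : R) :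
  is_ideal J -> J (t * \det (mxsub f g M) - 1) -> exists G, inner_inverse_mod J M G.
Proof.
move=> idJ Jt; have [G MG] := minor_inner_inverse f g.
exists (t *: G); rewrite /inner_inverse_mod -scalemxAr -scalemxAl -MG scalerA.
by move=> i j; rewrite !mxE -{2}(mul1r (M i j)) -mulrBl mulrC; exact: idealMl.
Qed.

(** * Contractibility at [alpha] against surviving minors *)

Theorem mainTheorem6
  (* the regular local ring Q with maximal ideal nn and residue field k *)
  (Q : comNzRingType) (nn : Q -> Prop) (k : fieldType) (pi : {rmorphism Q -> k})
  (HQ : regular_local nn)
  (Hpi_surj : forall y : k, exists x : Q, pi x = y)
  (Hpi_ker : forall x : Q, pi x = 0 <-> nn x)
  (* the regular sequence f_1, ..., f_c in nn^2, c >= 2 *)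
  (c : nat) (Hc : (2 <= c)%N) (f : 'I_c -> Q)
  (Hf_reg : regular_seq f) (Hf_sq : forall i, in_sq nn (f i))
  (* R = P / (w), an integral domain, presented by rho : P -> R *)
  (R : idomainType) (rho : {rmorphism {mpoly Q[c]} -> R})
  (Hrho_surj : forall y : R, exists p, rho p = y)
  (Hrho_ker : forall p, rho p = 0 <-> exists q, p = wpoly f * q)
  (* C in grK_tac(R) *)
  (b : int -> nat) (e : forall n : int, 'I_(b n) -> int)
  (dd : forall n : int, 'M[R]_(b n, b (n + 1)))
  (HC_hom : homogeneous_diffs rho e dd)
  (HC_tac : totally_acyclic dd) :
  (* for every n, with d_n = dd (n - 1) and d_(n+1) = dd n *)
  forall (n : int) (alpha : 'I_c -> k), (exists i, alpha i != 0) ->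
  forall a : 'I_c -> Q, (forall i, pi (a i) = alpha i) ->
    (~ contractible_mod (fun i : 'I_c => rho ('X_i - (a i)%:MP)) dd) <->
    in_zero_locus
      (fun q => bar_ideal rho pi (minor_ideal (rank_frac (dd (n - 1))) (dd (n - 1))) q /\
                bar_ideal rho pi (minor_ideal (rank_frac (dd n)) (dd n)) q)
      alpha.
Proof.
move=> n alpha [i0 alpha_i0] a pia.
(* The two differentials become [dd m] and [dd (m + 1)], with no cast between matrix sizes. *)
have [m ->] : exists m, n = m + 1 by exists (n - 1); rewrite subrK.
rewrite addrK.
have [_ [[idn [_ unitQ]] _]] := HQ.
have [dd_complex [ac dac]] := HC_tac.
have nf i : nn (f i).
  have [N [u [v [uv ->]]]] := Hf_sq i.
  by apply: (ideal_sum idn) => t _; apply: (idealMl idn); case: (uv t).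
pose g i : R := rho ('X_i - (a i)%:MP).
pose J := ideal_below g.
have idJ i : is_ideal (J i) := ideal_below_ideal g i.
(* Well defined because [w(a)] is a combination of the [f i], which lie in [nn]. *)
have [ev evP] : exists ev : {rmorphism R -> k}, forall p, ev (rho p) = pi p.@[a].
  apply: (rmorphism_lift (u := pi \o meval a) Hrho_surj) => p /Hrho_ker [q ->] /=.
  rewrite mevalM /wpoly raddf_sum (Hpi_ker _).2 //.
  rewrite mulrC; apply: (idealMl idn); apply: (ideal_sum idn) => i _ /=.
  by rewrite mevalM mevalC mulrC; exact: (idealMl idn).
have ev_bar p : ev (rho p) = (map_mpoly pi p).@[alpha].
  by rewrite evP -meval_map_mpoly; apply: meval_eq => i; rewrite pia.
have evJ y : J c y -> ev y = 0.
  move=> [r ->]; rewrite rmorph_sum big1 // => i _.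
  by rewrite rmorphM evP mevalB mevalXU mevalC subrr rmorph0 mulr0.
split=> [ncontr p [_ [P [minP ->]]] _|zero [s sP]].
  apply/eqP/negP => /negP; rewrite -ev_bar => nz; apply: ncontr.
  have dom : forall p q : {mpoly Q[c]}, p * q = 0 -> p = 0 \/ q = 0.
    move=> p' q'; apply: (mpoly_domain (h := rho \o @mpolyC c Q)) => x /=.
    exact: wpoly_quotient_constant_eq0.
  (* Evaluating the remaining variables gives the sum of the [a_j f_j]; were it zero, [a i0] would
     lie in [nn], against [alpha i0 != 0]. *)
  have w0 i : (i <= c)%N -> eval_below a i (wpoly f) != 0.
    move=> le_ic; apply/eqP => /(congr1 (eval_below a c)).
    rewrite eval_below_comp // eval_below_all rmorph0 => /(congr1 (meval a)).
    rewrite mevalC meval0 /wpoly raddf_sum => sum0.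
    have na : nn (a i0).
      apply: (regular_seq_syzygy idn nf Hf_reg); rewrite -[RHS]sum0.
      by apply: eq_bigr => l _; rewrite /= mevalM mevalC mevalXU mulrC.
    by move/eqP: alpha_i0; apply; rewrite -pia; apply/Hpi_ker.
  have J0 y : J 0%N y <-> y = 0 := ideal_below0 g y.
  have regJ (i : 'I_c) y : J i (g i * y) -> J i y.
    exact: (X_sub_const_regular Hrho_surj Hrho_ker dom (w0 _ (ltn_ord i))).
  have [ex exT] := exact_mod_regular_seq dd_complex idJ regJ (fun i y => ideal_belowS g i y)
    (acyclic_exact_mod J0 ac) (dual_acyclic_exact_mod J0 dac).
  have [u [v]] := minor_neq0_of_ideal minP nz.
  have [D DE] := Hrho_surj (\det (mxsub u v (dd (m + 1)))); rewrite -DE evP => nzD.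
  have [|q qP] := unitQ D.@[a]; first by move/Hpi_ker/eqP; apply/negP.
  have JD : J c (rho q%:MP * rho D - 1).
    (* Since [q D(a) = 1], what remains is a multiple of [D - D(a)], a combination of the
       [x_i - a_i]. *)
    have -> : rho q%:MP * rho D - 1 = rho q%:MP * rho (D - (D.@[a])%:MP).
      by rewrite rmorphB mulrBr -[X in _ = _ - X]rmorphM -mpolyCM [q * _]mulrC qP !rmorph1.
    apply: (idealMl (idJ c)).
    exact: ideal_below_map (sub_meval a D).
  rewrite DE in JD.
  have inn := inner_inverse_mod_all dd_complex (idJ c) ex exT
    (inner_inverse_of_unit_minor (idJ c) JD).
  have [s sP] := inner_inverse_mod_contraction dd_complex (idJ c) ex inn.
  by exists s => n' i j; apply/ideal_below_all; exact: sP.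
(* [ev] kills [J c], so the homotopy identity becomes an equality over [k]. *)
have evs : map_mx ev (dd (m + 1)) *m map_mx ev (s (m + 1)) +
           map_mx ev (s m) *m map_mx ev (dd m) = 1%:M.
  rewrite -!map_mxM -map_mxD -(map_mx1 ev); apply/matrixP => i j.
  rewrite [LHS]mxE [RHS]mxE; apply/subr0_eq; rewrite -rmorphB; apply: evJ.
  by have /ideal_below_all := sP m i j; rewrite !mxE.
have leb := rank_contraction evs.
have leA := rank_map_le_rank_frac ev (dd m).
have leB := rank_map_le_rank_frac ev (dd (m + 1)).
have rk := rank_frac_complex (dd_complex m).
(* The evaluated ranks sum to at least [b (m + 1)], the generic ones to at most that, and each
   evaluated rank is bounded by its generic one. *)
have [rkA rkB] : \rank (map_mx ev (dd m)) = rank_frac (dd m) /\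
                 \rank (map_mx ev (dd (m + 1))) = rank_frac (dd (m + 1)).
  split; apply/eqP; rewrite eqn_leq ?leA ?leB //=.
    by rewrite -(leq_add2r (rank_frac (dd (m + 1)))) (leq_trans rk) // (leq_trans leb) // leq_add2l.
  by rewrite -(leq_add2l (rank_frac (dd m))) (leq_trans rk) // (leq_trans leb) // leq_add2r.
have [u1 [v1 nz1]] := minor_neq0_of_rank rkA.
have [u2 [v2 nz2]] := minor_neq0_of_rank rkB.
have nz0 (x : R) : ev x != 0 -> x != 0 by apply: contraNneq => ->; rewrite rmorph0.
have [d1 [p1 [hp1 p1E]]] := homog_deg_minor (HC_hom m) (nz0 _ nz1).
have [d2 [p2 [hp2 p2E]]] := homog_deg_minor (HC_hom (m + 1)) (nz0 _ nz2).
have hp : homog_deg (d1 + d2) (p1 * p2).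
  by move: hp1 hp2; rewrite !homog_degE => hp1 hp2; apply: dhomogM.
have /eqP : (map_mpoly pi (p1 * p2)).@[alpha] = 0.
  apply: zero; last by exists (d1 + d2)%N; exact: homog_deg_map.
  split; exists (p1 * p2); split=> //; rewrite rmorphM p1E p2E; last exact: minor_ideal_minor.
  by rewrite mulrC; exact: minor_ideal_minor.
by rewrite -ev_bar !rmorphM p1E p2E mulf_eq0 (negPf nz1) (negPf nz2).
Qed.
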